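(* Let $\overline{D}(0;1)=\{z\in\mathbb{C}:|z|\le 1\}$ and $S^1=\{z\in\mathbb{C}:|z|=1\}$, and let $f:\overline{D}(0;1)\to\overline{D}(0;1)$ be non-constant and analytic. Suppose that $|f|$ has a maximum (over $\overline{D}(0;1)$) at $\alpha\in S^1$. Then: (1) the number $\alpha\dfrac{f'(\alpha)}{f(\alpha)}$ is real and $\alpha\dfrac{f'(\alpha)}{f(\alpha)}>0$; (2) if in addition $f(0)=0$, then $\alpha\dfrac{f'(\alpha)}{f(\alpha)}\ge 1$.
   Context: A function on an open set $\Omega\subset\mathbb{C}$ is analytic if around each $z_0\in\Omega$ it is given on some open disk centered at $z_0$ and contained in $\Omega$ by a convergent power series in $z-z_0$. For an arbitrary set $X\subset\mathbb{C}$, a function $f:X\to\mathbb{C}$ is analytic in $X$ if there exists an open set containing $X$ on which some extension of $f$ is analytic; $f'(\alpha)$ denotes the complex derivative at $\alpha$ of such an extension. *)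

(* Defs.v *)
From Stdlib Require Import Reals.
From Coquelicot Require Import Coquelicot.

Definition unit_disc (z : C) : Prop := (Cmod z <= 1)%R.

Definition unit_circle (z : C) : Prop := Cmod z = 1%R.

(* [open] is Coquelicot's: its neighbourhoods on [C] are the square ones, which
   give the same topology as the disks of [Cmod] (see [locally_C]). *)
Definition analytic_on_open (U : C -> Prop) (f : C -> C) : Prop :=
  open U /\
  forall z0 : C, U z0 ->
    exists (r : posreal) (a : nat -> C),
      forall z : C, (Cmod (z - z0) < r)%R ->
        U z /\ @is_pseries C_AbsRing C_NormedModule a (z - z0)%C (f z).

(* A function [X -> C] is represented by a total [f : C -> C] of which only the
   values on [X] are ever used. *)
Definition analytic_extension
    (X : C -> Prop) (f : C -> C) (U : C -> Prop) (g : C -> C) : Prop :=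
  analytic_on_open U g /\
  (forall z : C, X z -> U z) /\
  (forall z : C, X z -> g z = f z).

Definition analytic_in (X : C -> Prop) (f : C -> C) : Prop :=
  exists (U : C -> Prop) (g : C -> C), analytic_extension X f U g.

(* Main.v *)
Require Import Defs.
From Stdlib Require Import Reals Lra Lia Classical IndefiniteDescription List.
From Coquelicot Require Import Coquelicot.
Open Scope R_scope.

(** The engine is the leading term of a power series.  Near a point [z0] an
    analytic [F] is either constant or of the form
    [F (z0 + w) = F z0 + c w^m + O(w^(m+1))] with [c <> 0] and [m >= 1].  If
    [F z0 <> 0], then moving from [z0] in a direction [u] with
    [Re (c u^m / F z0) > 0] strictly increases the modulus
    ([leading_term_increase]).

    Positivity.  Take [z0 = alpha] and [u = alpha v].  When [Re v < 0] the move
    enters the disc, so maximality of [|f alpha|] forces [Re (d v^m) <= 0] on the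
    whole half-plane [Re v < 0], where [d = c alpha^m / f alpha <> 0]
    ([boundary_max_variation]).  If [m >= 2], the powers [v^m] sweep out all
    directions but at most one, so some [v] violates this
    ([exists_ascent_direction]).  Hence [m = 1], so [c = f'(alpha)] and [d] is the
    number [alpha f'(alpha) / f(alpha)]; a nonzero [d] that maps the open left
    half-plane into the closed one is a positive real ([half_plane_positive]).
    The leading term at [alpha] exists because a function constant near [alpha]
    would be constant on the disc, by the identity theorem
    ([identity_on_unit_disc]).

    The bound by 1.  When [f 0 = 0], the Schwarz lemma gives
    [|f z| <= |f alpha| |z|].  Along the radius, [z = (1 - s) alpha], the left side
    is at least [|f alpha| (1 - s (Re d + O(s)))] by the first-order expansion and
    the right side is [|f alpha| (1 - s)], whence [Re d >= 1].

    The Schwarz lemma comes from the maximum principle for the quotient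
    [k z = f z / z].  The division is never carried out on power series: with
    [lam = k z0], the function [f z - lam z] is analytic, vanishes at [z0] and
    equals [z (k z - k z0)], so its leading term at [z0] yields that of [k]. *)

(** * Expansions of power series *)

(** [F (z0 + w) = F z0 + c w^m + O(w^(m+1))].  The coefficient [c] may be zero, so
    that the case [m = 1] says that [F] is differentiable at [z0] with derivative [c]
    and quadratic error. *)
Definition leading_term (F : C -> C) (z0 c : C) (m : nat) : Prop :=
  exists K rho : R, 0 < K /\ 0 < rho /\
    forall w : C, Cmod w < rho ->
      Cmod (F (z0 + w) - F z0 - c * w ^ m)%C <= K * Cmod w ^ S m.

Lemma pow_n_Cpow (w : C) (n : nat) : @pow_n C_AbsRing w n = (w ^ n)%C.
Proof. induction n as [|n IH]; [reflexivity|]. simpl. rewrite IH. reflexivity. Qed.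

Lemma is_pseries_partial_sums (a : nat -> C) (w l : C) :
  @is_pseries C_AbsRing C_NormedModule a w l ->
  forall eps : R, 0 < eps -> exists N : nat, forall n, (N <= n)%nat ->
    Cmod (@sum_n C_AbelianMonoid (fun k => w ^ k * a k)%C n - l)%C < eps.
Proof.
  intros H eps Heps.
  pose proof (proj1 (filterlim_locally_ball_norm _ _) H (mkposreal eps Heps)) as [N HN].
  exists N. intros n Hn. specialize (HN n Hn).
  unfold ball_norm in HN. simpl in HN.
  rewrite (sum_n_ext _ (fun k => w ^ k * a k)%C) in HN.
  - exact HN.
  - intros k. rewrite pow_n_Cpow. reflexivity.
Qed.

Lemma sum_n_C_S (b : nat -> C) (n : nat) :
  @sum_n C_AbelianMonoid b (S n) = (@sum_n C_AbelianMonoid b n + b (S n))%C.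
Proof. apply (sum_Sn b n). Qed.

Lemma Cmod_sub_triangle (x y : C) : Cmod (x - y)%C <= Cmod x + Cmod y.
Proof. unfold Cminus. rewrite <- (Cmod_opp y). apply Cmod_triangle. Qed.

Lemma Cmod_sub_sym (x y : C) : Cmod (x - y)%C = Cmod (y - x)%C.
Proof. rewrite <- Cmod_opp. f_equal. ring. Qed.

Lemma Cmod_reverse_triangle (x y : C) : Rabs (Cmod x - Cmod y) <= Cmod (x - y)%C.
Proof.
  apply Rabs_le. split.
  - pose proof (Cmod_triangle x (y - x)%C) as H.
    replace (x + (y - x))%C with y in H by ring. rewrite Cmod_sub_sym in H. lra.
  - pose proof (Cmod_triangle y (x - y)%C) as H.
    replace (y + (x - y))%C with x in H by ring. lra.
Qed.

Lemma Cmod_RtoC_nonneg (r : R) : 0 <= r -> Cmod (RtoC r) = r.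
Proof. intros H. rewrite Cmod_R. now apply Rabs_pos_eq. Qed.

Lemma eventually_bounded_bounded (u : nat -> R) (N : nat) (B : R) :
  (forall n, (N <= n)%nat -> u n <= B) -> exists K, 0 < K /\ forall n, u n <= K.
Proof.
  revert B. induction N as [|N IH]; intros B H.
  - exists (Rmax B 1). split; [pose proof (Rmax_r B 1); lra|].
    intros n. eapply Rle_trans; [apply H; lia|apply Rmax_l].
  - apply (IH (Rmax B (u N))). intros n Hn.
    destruct (Nat.eq_dec n N) as [->|Hne]; [apply Rmax_r|].
    eapply Rle_trans; [apply H; lia|apply Rmax_l].
Qed.

(** Each term is a difference of two partial sums, which stay close to the limit
    for large indices. *)
Lemma pseries_terms_bounded (a : nat -> C) (w l : C) :
  @is_pseries C_AbsRing C_NormedModule a w l ->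
  exists K, 0 < K /\ forall n, Cmod (a n) * Cmod w ^ n <= K.
Proof.
  intros H. destruct (is_pseries_partial_sums _ _ _ H 1 Rlt_0_1) as [N HN].
  apply (eventually_bounded_bounded _ (S N) 2).
  intros n Hn. destruct n as [|n]; [lia|].
  pose proof (HN n ltac:(lia)) as H1. pose proof (HN (S n) ltac:(lia)) as H2.
  rewrite sum_n_C_S in H2.
  pose proof (Cmod_sub_triangle
    (@sum_n C_AbelianMonoid (fun k => w ^ k * a k)%C n + w ^ S n * a (S n) - l)%C
    (@sum_n C_AbelianMonoid (fun k => w ^ k * a k)%C n - l)%C) as H3.
  match type of H3 with Cmod ?x <= _ =>
    replace x with (w ^ S n * a (S n))%C in H3 by ring end.
  rewrite Cmod_mult, Cmod_pow in H3. lra.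
Qed.

Lemma pseries_sub_affine (a : nat -> C) (w l c0 c1 : C) :
  @is_pseries C_AbsRing C_NormedModule a w l ->
  @is_pseries C_AbsRing C_NormedModule
    (fun n => match n with 0%nat => a 0%nat - c0 | 1%nat => a 1%nat - c1 | _ => a n end)%C
    w (l - (c0 + c1 * w))%C.
Proof.
  intros H.
  pose (b := fun n : nat => match n with 0%nat => c0 | 1%nat => c1 | _ => RtoC 0 end).
  assert (Hb : @is_pseries C_AbsRing C_NormedModule b w (c0 + c1 * w)%C).
  { unfold is_pseries, is_series.
    apply filterlim_ext_loc with (f := fun _ => (c0 + c1 * w)%C : C_NormedModule);
      [|apply filterlim_const].
    exists 1%nat. intros n Hn. induction Hn as [|n Hn IH].
    - rewrite sum_Sn, sum_O. unfold b. simpl pow_n.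
      change (c0 + c1 * w = 1 * c0 + (w * 1) * c1)%C. ring.
    - rewrite sum_Sn, <- IH. destruct n as [|n]; [lia|].
      change (b (S (S n))) with (@zero C_NormedModule).
      rewrite (scal_zero_r (V := C_NormedModule)), plus_zero_r. reflexivity. }
  pose proof (is_pseries_minus _ _ _ _ _ H Hb) as Hm.
  unfold is_pseries in Hm |- *.
  eapply is_series_ext; [|exact Hm].
  intros n. cbv beta. f_equal. unfold PS_minus, PS_plus, PS_opp, b.
  destruct n as [|[|n]]; [reflexivity|reflexivity|].
  change (a (S (S n)) + - 0 = a (S (S n)))%C. ring.
Qed.


(** Comparison with a geometric series of ratio [|w| / rho <= 1 / 2]: the terms
    after the [m]-th add up to at most twice the first bound. *)
Lemma pseries_remainder (a : nat -> C) (w l : C) (rho K : R) (m : nat) :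
  @is_pseries C_AbsRing C_NormedModule a w l ->
  0 < rho -> (forall n, Cmod (a n) * rho ^ n <= K) ->
  (1 <= m)%nat -> (forall j, (1 <= j < m)%nat -> a j = RtoC 0) ->
  Cmod w <= rho / 2 ->
  Cmod (l - a 0%nat - a m * w ^ m)%C <= 2 * K * (Cmod w / rho) ^ S m.
Proof.
  intros Hl Hrho HK Hm Hz Hw.
  set (t := Cmod w / rho).
  assert (Ht : 0 <= t <= 1 / 2).
  { unfold t. split.
    - apply Rdiv_le_0_compat; [apply Cmod_ge_0|lra].
    - apply (Rmult_le_reg_r rho); [lra|]. unfold Rdiv at 1.
      rewrite Rmult_assoc, Rinv_l, Rmult_1_r by lra. lra. }
  assert (Hterm : forall n, Cmod (w ^ n * a n)%C <= K * t ^ n).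
  { intros n. rewrite Cmod_mult, Cmod_pow.
    replace (Cmod w) with (t * rho) by (unfold t; field; lra).
    rewrite Rpow_mult_distr.
    replace (t ^ n * rho ^ n * Cmod (a n)) with (Cmod (a n) * rho ^ n * t ^ n) by ring.
    apply Rmult_le_compat_r; [apply pow_le; lra|apply HK]. }
  assert (HK0 : 0 <= K).
  { eapply Rle_trans; [|apply (HK 0%nat)]. simpl. rewrite Rmult_1_r. apply Cmod_ge_0. }
  assert (Hlow : forall n, (n < m)%nat ->
    @sum_n C_AbelianMonoid (fun k => w ^ k * a k)%C n = a 0%nat).
  { induction n as [|n IH]; intros Hn.
    - rewrite sum_O. simpl. ring.
    - rewrite sum_n_C_S, IH by lia. rewrite (Hz (S n)) by lia.
      change (a 0%nat + w ^ S n * 0 = a 0%nat)%C. ring. }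
  (* The factor [2 - 2 (1/2)^p] is the partial sum of the geometric series, kept in
     the bound so that the induction goes through. *)
  assert (Hpart : forall p,
    Cmod (@sum_n C_AbelianMonoid (fun k => w ^ k * a k)%C (m + p)%nat
          - a 0%nat - a m * w ^ m)%C <= K * t ^ S m * (2 - 2 * (1 / 2) ^ p)).
  { induction p as [|p IH].
    - rewrite Nat.add_0_r. destruct m as [|m]; [lia|].
      rewrite sum_n_C_S, Hlow by lia.
      match goal with |- Cmod ?x <= _ => replace x with (RtoC 0) by ring end.
      rewrite Cmod_0, pow_O. apply Req_le. ring.
    - rewrite Nat.add_succ_r, sum_n_C_S.
      match goal with |- Cmod (?s + ?x - ?y - ?z)%C <= _ =>
        replace (s + x - y - z)%C with ((s - y - z) + x)%C by ring end.
      eapply Rle_trans; [apply Cmod_triangle|].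
      pose proof (Hterm (S (m + p))) as H1.
      assert (H2 : t ^ p <= (1 / 2) ^ p) by (apply pow_incr; lra).
      assert (H3 : K * t ^ S (m + p) <= K * t ^ S m * (1 / 2) ^ p).
      { replace (S (m + p))%nat with (S m + p)%nat by lia. rewrite pow_add.
        rewrite Rmult_assoc. apply Rmult_le_compat_l; [lra|].
        apply Rmult_le_compat_l; [apply pow_le; lra|exact H2]. }
      rewrite <- (tech_pow_Rmult (1 / 2) p). lra. }
  apply le_epsilon. intros eps Heps.
  destruct (is_pseries_partial_sums _ _ _ Hl eps Heps) as [N HN].
  specialize (HN (m + N)%nat ltac:(lia)). specialize (Hpart N).
  rewrite Cmod_sub_sym in HN.
  match type of HN with Cmod (l - ?s)%C < _ =>
    replace (l - a 0%nat - a m * w ^ m)%C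
      with ((l - s) + (s - a 0%nat - a m * w ^ m))%C by ring end.
  eapply Rle_trans; [apply Cmod_triangle|].
  assert (H1 : 0 <= K * t ^ S m) by (apply Rmult_le_pos; [lra|apply pow_le; lra]).
  assert (H2 : 0 <= (1 / 2) ^ N) by (apply pow_le; lra).
  nra.
Qed.

Lemma is_pseries_C_unique (a : nat -> C) (w l1 l2 : C) :
  @is_pseries C_AbsRing C_NormedModule a w l1 ->
  @is_pseries C_AbsRing C_NormedModule a w l2 -> l1 = l2.
Proof.
  intros H1 H2. apply (filterlim_locally_unique (V := C_NormedModule) _ _ _ H1 H2).
Qed.

Lemma pseries_at_0 (a : nat -> C) (l : C) :
  @is_pseries C_AbsRing C_NormedModule a (RtoC 0) l -> l = a 0%nat.
Proof.
  intros H. apply (is_pseries_C_unique a (RtoC 0)); [exact H|].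
  apply (is_pseries_0 (V := C_NormedModule) a).
Qed.

Lemma pseries_constant (a : nat -> C) (w : C) :
  (forall n, (1 <= n)%nat -> a n = RtoC 0) ->
  @is_pseries C_AbsRing C_NormedModule a w (a 0%nat).
Proof.
  intros Ha. unfold is_pseries, is_series.
  apply filterlim_ext with (f := fun _ => a 0%nat : C_NormedModule);
    [|apply filterlim_const].
  induction x as [|n IH].
  - rewrite sum_O. symmetry. apply (scal_one (V := C_NormedModule)).
  - rewrite sum_Sn, <- IH, (Ha (S n)) by lia.
    change (RtoC 0) with (@zero C_NormedModule).
    rewrite (scal_zero_r (V := C_NormedModule)), plus_zero_r. reflexivity.
Qed.

(** The coefficients are bounded by a geometric sequence on any circle of
    convergence; the circle of radius [r / 2] leaves room for [pseries_remainder] on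
    the disc of radius [r / 4]. *)
Lemma pseries_leading_term (F : C -> C) (z0 : C) (r : R) (a : nat -> C) (m : nat) :
  0 < r ->
  (forall w, Cmod w < r -> @is_pseries C_AbsRing C_NormedModule a w (F (z0 + w)%C)) ->
  (1 <= m)%nat -> (forall j, (1 <= j < m)%nat -> a j = RtoC 0) ->
  leading_term F z0 (a m) m.
Proof.
  intros Hr Ha Hm Hz.
  assert (Hr2 : Cmod (RtoC (r / 2)) = r / 2) by (apply Cmod_RtoC_nonneg; lra).
  destruct (pseries_terms_bounded a (RtoC (r / 2)) _ (Ha (RtoC (r / 2)) ltac:(lra))) as [K [HK HKn]].
  rewrite Hr2 in HKn.
  assert (H0 : F z0 = a 0%nat).
  { apply pseries_at_0.
    replace (F z0) with (F (z0 + 0)%C) by (f_equal; ring).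
    apply Ha. rewrite Cmod_0. lra. }
  exists (2 * K * (/ (r / 2)) ^ S m), (r / 4). repeat split; [|lra|].
  - apply Rmult_lt_0_compat; [lra|]. apply pow_lt, Rinv_0_lt_compat. lra.
  - intros w Hw. rewrite H0, Rmult_assoc, <- Rpow_mult_distr.
    rewrite (Rmult_comm (/ (r / 2))).
    apply pseries_remainder; auto; try lra. apply Ha. lra.
Qed.

Lemma pseries_dichotomy (F : C -> C) (z0 : C) (r : R) (a : nat -> C) :
  0 < r ->
  (forall w, Cmod w < r -> @is_pseries C_AbsRing C_NormedModule a w (F (z0 + w)%C)) ->
  (forall w, Cmod w < r -> F (z0 + w)%C = F z0) \/
  exists m, (1 <= m)%nat /\ a m <> RtoC 0 /\ leading_term F z0 (a m) m.
Proof.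
  intros Hr Ha.
  destruct (classic (exists m, (1 <= m)%nat /\ a m <> RtoC 0)) as [Hex|Hno].
  - right.
    destruct (Wf_nat.dec_inh_nat_subset_has_unique_least_element
      (fun m => (1 <= m)%nat /\ a m <> RtoC 0) (fun n => classic _) Hex)
      as [m [[[Hm Ham] Hleast] _]].
    exists m. split; [exact Hm|]. split; [exact Ham|].
    apply (pseries_leading_term F z0 r); auto.
    intros j Hj. destruct (classic (a j = RtoC 0)) as [H|H]; [exact H|].
    specialize (Hleast j (conj (proj1 Hj) H)). lia.
  - left.
    assert (Hconst : forall w, Cmod w < r -> F (z0 + w)%C = a 0%nat).
    { intros w Hw. apply (is_pseries_C_unique a w); [now apply Ha|].
      apply pseries_constant. intros n Hn.
      destruct (classic (a n = RtoC 0)) as [H|H]; [exact H|].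
      destruct Hno. now exists n. }
    intros w Hw. rewrite (Hconst w Hw).
    rewrite <- (Hconst (RtoC 0)) by (rewrite Cmod_0; lra).
    f_equal. ring.
Qed.

(** * Functions with a leading term *)

Lemma leading_term_continuous (F : C -> C) (z0 c : C) (m : nat) :
  (1 <= m)%nat -> leading_term F z0 c m ->
  forall eps, 0 < eps -> exists delta, 0 < delta /\
    forall w, Cmod w < delta -> Cmod (F (z0 + w) - F z0)%C < eps.
Proof.
  intros Hm (K & rho & HK & Hrho & H) eps Heps.
  pose proof (Cmod_ge_0 c) as Hc.
  assert (Hden : 0 < Cmod c + K + 1) by lra.
  exists (Rmin rho (Rmin 1 (eps / (Cmod c + K + 1)))).
  assert (He : 0 < eps / (Cmod c + K + 1)) by (apply Rdiv_lt_0_compat; lra).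
  split; [repeat apply Rmin_pos; lra|].
  intros w Hw.
  pose proof (Rmin_l rho (Rmin 1 (eps / (Cmod c + K + 1)))) as L1.
  pose proof (Rmin_r rho (Rmin 1 (eps / (Cmod c + K + 1)))) as L2.
  pose proof (Rmin_l 1 (eps / (Cmod c + K + 1))) as L3.
  pose proof (Rmin_r 1 (eps / (Cmod c + K + 1))) as L4.
  specialize (H w ltac:(lra)).
  pose proof (Cmod_ge_0 w) as Hw0.
  destruct m as [|m]; [lia|].
  assert (Hp : 0 <= Cmod w ^ m <= 1).
  { split; [now apply pow_le|]. rewrite <- (pow1 m). apply pow_incr. lra. }
  assert (Hw1 : Cmod w * (Cmod c + K + 1) < eps).
  { apply Rlt_le_trans with (eps / (Cmod c + K + 1) * (Cmod c + K + 1)).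
    - apply Rmult_lt_compat_r; lra.
    - apply Req_le. field. lra. }
  replace (F (z0 + w) - F z0)%C with ((F (z0 + w) - F z0 - c * w ^ S m) + c * w ^ S m)%C
    by ring.
  eapply Rle_lt_trans; [apply Cmod_triangle|].
  rewrite Cmod_mult, Cmod_pow. simpl pow in H |- *.
  set (p := Cmod w ^ m) in *. set (x := Cmod w) in *.
  assert (x * p <= x) by nra.
  assert (x * (x * p) <= x) by nra.
  assert (Cmod c * (x * p) <= Cmod c * x) by (apply Rmult_le_compat_l; lra).
  assert (K * (x * (x * p)) <= K * x) by (apply Rmult_le_compat_l; lra).
  lra.
Qed.

Lemma leading_term_isolated (F : C -> C) (z0 c : C) (m : nat) :
  (1 <= m)%nat -> c <> RtoC 0 -> leading_term F z0 c m ->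
  forall v, exists delta, 0 < delta /\
    forall w, w <> RtoC 0 -> Cmod w < delta -> F (z0 + w)%C <> v.
Proof.
  intros Hm Hc HF v.
  destruct (classic (v = F z0)) as [->|Hv].
  - destruct HF as (K & rho & HK & Hrho & H).
    apply Cmod_gt_0 in Hc.
    exists (Rmin rho (Cmod c / K)).
    assert (Hq : 0 < Cmod c / K) by (apply Rdiv_lt_0_compat; lra).
    split; [now apply Rmin_pos|].
    intros w Hw0 Hw Heq.
    pose proof (Rmin_l rho (Cmod c / K)). pose proof (Rmin_r rho (Cmod c / K)).
    specialize (H w ltac:(lra)). rewrite Heq in H.
    replace (F z0 - F z0 - c * w ^ m)%C with (- (c * w ^ m))%C in H by ring.
    rewrite Cmod_opp, Cmod_mult, Cmod_pow in H. simpl pow in H.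
    apply Cmod_gt_0 in Hw0.
    assert (Hp : 0 < Cmod w ^ m) by now apply pow_lt.
    assert (Hlt : Cmod w * K < Cmod c).
    { apply Rlt_le_trans with (Cmod c / K * K); [apply Rmult_lt_compat_r; lra|].
      apply Req_le. field. lra. }
    nra.
  - assert (Hd : 0 < Cmod (v - F z0)%C).
    { apply Cmod_gt_0. intros E. apply Hv.
      replace v with ((v - F z0) + F z0)%C by ring. rewrite E. ring. }
    destruct (leading_term_continuous F z0 c m Hm HF _ Hd) as [delta [Hdelta H]].
    exists delta. split; [exact Hdelta|]. intros w _ Hw Heq.
    specialize (H w Hw). rewrite Heq in H. lra.
Qed.

(** Divide by [F z0] and bound the modulus below by the real part:
    [F (z0 + s u) / F z0 = 1 + s^m (c u^m / F z0) + O(s^(m+1))].  No sign of the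
    first-order term is assumed, since the bound is also used along inward radii, where the
    modulus decreases. *)
Lemma leading_term_first_variation (F : C -> C) (z0 c : C) (m : nat) :
  leading_term F z0 c m -> F z0 <> RtoC 0 -> forall u : C,
  exists K s0, 0 < K /\ 0 < s0 /\ forall s, 0 < s < s0 ->
    Cmod (F z0) * (1 + s ^ m * (Re (c * u ^ m / F z0)%C - K * s))
      <= Cmod (F (z0 + s * u)%C).
Proof.
  intros (K & rho & HK & Hrho & H) HF0 u.
  pose proof (proj1 (Cmod_gt_0 _) HF0) as HM.
  pose proof (Cmod_ge_0 u) as Hu.
  exists (K * (Cmod u + 1) ^ S m / Cmod (F z0)), (rho / (Cmod u + 1)).
  assert (Hup : 0 < (Cmod u + 1) ^ S m) by (apply pow_lt; lra).
  split; [apply Rdiv_lt_0_compat; [now apply Rmult_lt_0_compat|lra]|].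
  split; [apply Rdiv_lt_0_compat; lra|].
  intros s [Hs0 Hs].
  assert (Hsu : Cmod (s * u)%C = s * Cmod u).
  { rewrite Cmod_mult, Cmod_RtoC_nonneg; lra. }
  assert (Hsr : Cmod (s * u)%C < rho).
  { rewrite Hsu. apply Rle_lt_trans with (s * (Cmod u + 1)); [nra|].
    apply Rlt_le_trans with (rho / (Cmod u + 1) * (Cmod u + 1)).
    - apply Rmult_lt_compat_r; lra.
    - apply Req_le. field. lra. }
  specialize (H _ Hsr). rewrite Hsu in H.
  set (E := (F (z0 + s * u) - F z0 - c * (s * u) ^ m)%C) in *.
  assert (Hdec : (F (z0 + s * u) / F z0 = 1 + RtoC (s ^ m) * (c * u ^ m / F z0) + E / F z0)%C).
  { unfold E. rewrite Cpow_mult_l, RtoC_pow. field. exact HF0. }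
  assert (HE : Cmod (E / F z0)%C <= s ^ m * (K * (Cmod u + 1) ^ S m / Cmod (F z0) * s)).
  { rewrite Cmod_div by exact HF0.
    replace (s ^ m * (K * (Cmod u + 1) ^ S m / Cmod (F z0) * s))
      with (K * (s * (Cmod u + 1)) ^ S m / Cmod (F z0)).
    - apply Rmult_le_compat_r; [left; now apply Rinv_0_lt_compat|].
      eapply Rle_trans; [exact H|].
      apply Rmult_le_compat_l; [lra|]. apply pow_incr. split; [nra|].
      apply Rmult_le_compat_l; lra.
    - rewrite Rpow_mult_distr. simpl pow. field. lra. }
  replace (Cmod (F (z0 + s * u)%C)) with (Cmod (F z0) * Cmod (F (z0 + s * u) / F z0)%C).
  2: { rewrite Cmod_div by exact HF0. field. lra. }
  apply Rmult_le_compat_l; [lra|].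
  eapply Rle_trans; [|eapply Rle_trans; [apply Rle_abs|apply re_le_Cmod]].
  rewrite Hdec.
  pose proof (re_le_Cmod (E / F z0)%C) as HRe.
  apply Rabs_le_between in HRe.
  set (d := (c * u ^ m / F z0)%C) in *. set (e := (E / F z0)%C) in *.
  assert (HR : Re (1 + RtoC (s ^ m) * d + e)%C = 1 + s ^ m * Re d + Re e).
  { destruct d, e. simpl. ring. }
  rewrite HR. lra.
Qed.

Lemma leading_term_increase (F : C -> C) (z0 c u : C) (m : nat) :
  leading_term F z0 c m -> F z0 <> RtoC 0 ->
  0 < Re (c * u ^ m / F z0)%C ->
  exists s0, 0 < s0 /\ forall s, 0 < s < s0 -> Cmod (F z0) < Cmod (F (z0 + s * u)%C).
Proof.
  intros HF HF0 Hpos.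
  destruct (leading_term_first_variation F z0 c m HF HF0 u) as (K & s0 & HK & Hs0 & H).
  set (d := Re (c * u ^ m / F z0)%C) in *.
  exists (Rmin s0 (d / K)).
  assert (Hd : 0 < d / K) by (apply Rdiv_lt_0_compat; lra).
  split; [now apply Rmin_pos|]. intros s [Hs1 Hs2].
  pose proof (Rmin_l s0 (d / K)). pose proof (Rmin_r s0 (d / K)).
  apply Rlt_le_trans with (2 := H s ltac:(lra)).
  assert (HM : 0 < Cmod (F z0)) by now apply Cmod_gt_0.
  assert (K * s < d).
  { apply Rlt_le_trans with (K * (d / K)); [apply Rmult_lt_compat_l; lra|].
    apply Req_le. field. lra. }
  assert (Hp : 0 < s ^ m) by (apply pow_lt; lra).
  assert (0 < s ^ m * (d - K * s)) by (apply Rmult_lt_0_compat; lra).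
  assert (0 < Cmod (F z0) * (s ^ m * (d - K * s))) by now apply Rmult_lt_0_compat.
  lra.
Qed.

Lemma leading_term_is_derive (F : C -> C) (z0 c : C) :
  leading_term F z0 c 1 -> @is_derive C_AbsRing C_NormedModule F z0 c.
Proof.
  intros (K & rho & HK & Hrho & H).
  split; [apply is_linear_scal_l|].
  intros x Hx.
  apply (is_filter_lim_locally_unique (V := AbsRing_NormedModule C_AbsRing)) in Hx.
  change (z0 = x) in Hx. subst x.
  intros eps.
  apply (locally_le_locally_norm (V := AbsRing_NormedModule C_AbsRing)).
  assert (Hd : 0 < Rmin rho (eps / K)).
  { apply Rmin_pos; [lra|]. apply Rdiv_lt_0_compat; [apply cond_pos|lra]. }
  exists (mkposreal _ Hd). intros y Hy.
  unfold ball_norm in Hy.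
  change (Cmod (y - z0)%C < Rmin rho (eps / K)) in Hy.
  change (Cmod ((F y - F z0) - (y - z0) * c)%C <= eps * Cmod (y - z0)%C).
  pose proof (Rmin_l rho (eps / K)). pose proof (Rmin_r rho (eps / K)).
  specialize (H (y - z0)%C ltac:(lra)).
  assert (Hy1 : forall x y : C, (x + (y - x) = y)%C) by (intros; ring).
  assert (Hy2 : forall a x : C, (a - x * c = a - c * x ^ 1)%C) by (intros; ring).
  rewrite Hy1 in H. rewrite Hy2.
  eapply Rle_trans; [exact H|]. simpl pow. rewrite Rmult_1_r, <- Rmult_assoc.
  apply Rmult_le_compat_r; [apply Cmod_ge_0|].
  apply Rle_trans with (K * (eps / K)); [apply Rmult_le_compat_l; lra|].
  apply Req_le. field. lra.
Qed.

(** * Directions of increase *)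

Lemma de_Moivre (x : R) (n : nat) :
  (((cos x, sin x) : C) ^ n)%C = (cos (INR n * x), sin (INR n * x)).
Proof.
  induction n as [|n IH].
  - simpl. rewrite Rmult_0_l, cos_0, sin_0. reflexivity.
  - rewrite Cpow_S, IH, S_INR.
    replace ((INR n + 1) * x) with (x + INR n * x) by ring.
    rewrite cos_plus, sin_plus. unfold Cmult. simpl. f_equal; ring.
Qed.

(** The angle ranges over an open interval of length [2 PI], which misses one
    direction only; among the angles [PI / 2], [PI], [3 PI / 2] and [PI / 4] one always
    works, the last being used when the missing angle would be the natural choice. *)
Lemma exists_angle_positive_real_part (d : C) :
  d <> RtoC 0 ->
  exists psi, 0 < psi < 2 * PI /\ 0 < Re (d * (cos psi, sin psi))%C.
Proof.
  intros Hd. pose proof PI_RGT_0 as Hpi. destruct d as [x y].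
  destruct (Rtotal_order y 0) as [Hy|[Hy|Hy]].
  - exists (PI / 2). split; [lra|]. simpl. rewrite cos_PI2, sin_PI2. lra.
  - subst y. destruct (Rtotal_order x 0) as [Hx|[Hx|Hx]].
    + exists PI. split; [lra|]. simpl. rewrite cos_PI, sin_PI. lra.
    + subst x. now destruct Hd.
    + exists (PI / 4). split; [lra|]. simpl.
      assert (0 < cos (PI / 4)) by (apply cos_gt_0; lra). nra.
  - exists (3 * (PI / 2)). split; [lra|]. simpl. rewrite cos_3PI2, sin_3PI2. lra.
Qed.

(** Write [v = i e^(i psi / m)], so that [v^m = i^m e^(i psi)] takes every direction
    but one as [psi] runs through the interval from [0] to [2 PI].  For [m >= 2]
    the angle [psi / m] lies between [0] and [PI], which puts [v] in the left half-plane. *)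
Lemma exists_ascent_direction (d : C) (m : nat) :
  d <> RtoC 0 -> (1 <= m)%nat ->
  exists v : C, Cmod v = 1 /\ 0 < Re (d * v ^ m)%C /\ ((2 <= m)%nat -> Re v < 0).
Proof.
  intros Hd Hm.
  destruct (exists_angle_positive_real_part (d * Ci ^ m)%C) as (psi & Hpsi & Hpos).
  { intros E. apply (f_equal Cmod) in E.
    rewrite Cmod_mult, Cmod_pow, Cmod_Ci, pow1, Cmod_0, Rmult_1_r in E.
    apply Cmod_eq_0 in E. contradiction. }
  assert (Hm0 : 1 <= INR m) by (change 1 with (INR 1); now apply le_INR).
  set (x := psi / INR m).
  assert (Hx : INR m * x = psi) by (unfold x; field; lra).
  exists (Ci * (cos x, sin x))%C. split; [|split].
  - rewrite Cmod_mult, Cmod_Ci, Rmult_1_l. unfold Cmod. simpl.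
    replace (cos x * (cos x * 1) + sin x * (sin x * 1))
      with ((sin x)² + (cos x)²) by (unfold Rsqr; ring).
    rewrite sin2_cos2. apply sqrt_1.
  - rewrite Cpow_mult_l, de_Moivre, Hx, Cmult_assoc. exact Hpos.
  - intros Hm2.
    assert (H2 : 2 <= INR m) by (change 2 with (INR 2); now apply le_INR).
    assert (0 < sin x) by (apply sin_gt_0; nra).
    simpl. lra.
Qed.

(** * Local form of analytic functions *)

Definition locally_constant_at (F : C -> C) (z0 : C) : Prop :=
  exists delta, 0 < delta /\ forall w, Cmod w < delta -> F (z0 + w)%C = F z0.

(** The only consequence of analyticity that the maximum principle uses.  It is
    stated for functions not known to be analytic because it passes easily to the
    quotient [g z / z]. *)
Definition local_form_at (F : C -> C) (z0 : C) : Prop :=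
  locally_constant_at F z0 \/
  exists m c, (1 <= m)%nat /\ c <> RtoC 0 /\ leading_term F z0 c m.

Lemma local_form_continuous (F : C -> C) (z0 : C) :
  local_form_at F z0 ->
  forall eps, 0 < eps -> exists delta, 0 < delta /\
    forall w, Cmod w < delta -> Cmod (F (z0 + w) - F z0)%C < eps.
Proof.
  intros [(delta & Hdelta & H)|(m & c & Hm & _ & H)] eps Heps.
  - exists delta. split; [exact Hdelta|]. intros w Hw. rewrite (H w Hw).
    replace (F z0 - F z0)%C with (RtoC 0) by ring. rewrite Cmod_0. exact Heps.
  - now apply (leading_term_continuous F z0 c m).
Qed.

Lemma local_form_constant_or_isolated (F : C -> C) (z0 v : C) :
  local_form_at F z0 ->
  locally_constant_at F z0 \/
  exists delta, 0 < delta /\ forall w, w <> RtoC 0 -> Cmod w < delta -> F (z0 + w)%C <> v.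
Proof.
  intros [H|(m & c & Hm & Hc & H)]; [now left|right].
  now apply (leading_term_isolated F z0 c m).
Qed.

(** The local maximum principle: a leading term always has a direction along which
    the modulus grows. *)
Lemma local_max_locally_constant (F : C -> C) (z0 : C) (delta : R) :
  local_form_at F z0 -> 0 < delta ->
  (forall w, Cmod w < delta -> Cmod (F (z0 + w)%C) <= Cmod (F z0)) ->
  locally_constant_at F z0.
Proof.
  intros [H|(m & c & Hm & Hc & H)] Hdelta Hmax; [exact H|].
  destruct (classic (F z0 = RtoC 0)) as [H0|H0].
  - exists delta. split; [exact Hdelta|]. intros w Hw. specialize (Hmax w Hw).
    rewrite H0, Cmod_0 in Hmax. rewrite H0. apply Cmod_eq_0.
    pose proof (Cmod_ge_0 (F (z0 + w)%C)). lra.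
  - exfalso.
    destruct (exists_ascent_direction (c / F z0)%C m) as (v & Hv & Hpos & _); [|exact Hm|].
    { intros E. apply Hc. replace c with (c / F z0 * F z0)%C by (field; exact H0).
      rewrite E. ring. }
    destruct (leading_term_increase F z0 c v m H H0) as (s0 & Hs0 & Hinc).
    { replace (c * v ^ m / F z0)%C with (c / F z0 * v ^ m)%C by (field; exact H0).
      exact Hpos. }
    set (s := Rmin s0 delta / 2).
    pose proof (Rmin_l s0 delta). pose proof (Rmin_r s0 delta).
    assert (0 < Rmin s0 delta) by now apply Rmin_pos.
    specialize (Hinc s ltac:(unfold s; lra)).
    specialize (Hmax (s * v)%C).
    rewrite Cmod_mult, Hv, Cmod_RtoC_nonneg in Hmax by (unfold s; lra).
    specialize (Hmax ltac:(unfold s; lra)). lra.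
Qed.

Lemma analytic_series_at (U : C -> Prop) (F : C -> C) (z0 : C) :
  analytic_on_open U F -> U z0 ->
  exists (r : R) (a : nat -> C), 0 < r /\ forall w, Cmod w < r ->
    U (z0 + w)%C /\ @is_pseries C_AbsRing C_NormedModule a w (F (z0 + w)%C).
Proof.
  intros [_ H] Hz. destruct (H z0 Hz) as (r & a & Hr).
  exists r, a. split; [apply cond_pos|]. intros w Hw.
  assert (E : (z0 + w - z0 = w)%C) by ring.
  specialize (Hr (z0 + w)%C). rewrite E in Hr. now apply Hr.
Qed.

Lemma series_local_form (F : C -> C) (z0 : C) (r : R) (a : nat -> C) :
  0 < r ->
  (forall w, Cmod w < r -> @is_pseries C_AbsRing C_NormedModule a w (F (z0 + w)%C)) ->
  local_form_at F z0.
Proof.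
  intros Hr Ha. destruct (pseries_dichotomy F z0 r a Hr Ha) as [H|(m & Hm & Ham & H)].
  - left. now exists r.
  - right. now exists m, (a m).
Qed.

Lemma analytic_local_form (U : C -> Prop) (F : C -> C) (z0 : C) :
  analytic_on_open U F -> U z0 -> local_form_at F z0.
Proof.
  intros HF Hz. destruct (analytic_series_at U F z0 HF Hz) as (r & a & Hr & Ha).
  apply (series_local_form F z0 r a Hr). intros w Hw. now apply Ha.
Qed.

Lemma analytic_sub_linear (U : C -> Prop) (F : C -> C) (lam : C) :
  analytic_on_open U F -> analytic_on_open U (fun z => F z - lam * z)%C.
Proof.
  intros [HU H]. split; [exact HU|]. intros z0 Hz.
  destruct (H z0 Hz) as (r & a & Hr).
  exists r. eexists. intros z Hzr. destruct (Hr z Hzr) as [HUz Hs].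
  split; [exact HUz|].
  pose proof (pseries_sub_affine a (z - z0)%C (F z) (lam * z0)%C lam Hs) as Ha.
  replace (F z - lam * z)%C with (F z - (lam * z0 + lam * (z - z0)))%C by ring.
  exact Ha.
Qed.

(** * The identity theorem *)

(** Let [T] be the last time up to which [F] keeps its initial value along the
    segment.  The values just before [T] show that [F] takes that value at points
    accumulating at the point reached at time [T], so [F] has no isolated solution
    there and is constant nearby; then [T] could be increased unless it is [1]. *)
Lemma identity_on_segment (U : C -> Prop) (F : C -> C) (a b : C) :
  analytic_on_open U F ->
  (forall t, 0 <= t <= 1 -> U (a + t * (b - a))%C) ->
  locally_constant_at F a -> F b = F a.
Proof.
  intros HF HU (d0 & Hd0 & Hc0).
  destruct (classic (b = a)) as [->|Hab]; [reflexivity|].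
  assert (HL : 0 < Cmod (b - a)%C).
  { apply Cmod_gt_0. intros E. apply Hab.
    replace b with ((b - a) + a)%C by ring. rewrite E. ring. }
  set (L := Cmod (b - a)%C) in *.
  set (gam := fun t : R => (a + t * (b - a))%C).
  assert (Hgam : forall s t, gam t = (gam s + RtoC (t - s) * (b - a))%C).
  { intros s t. unfold gam. rewrite RtoC_minus. ring. }
  assert (Hdist : forall s t, Cmod (RtoC (t - s) * (b - a))%C = Rabs (t - s) * L).
  { intros s t. now rewrite Cmod_mult, Cmod_R. }
  set (E := fun T => 0 <= T <= 1 /\ forall t, 0 <= t <= T -> F (gam t) = F a).
  assert (Hsmall : forall eps, 0 < eps -> exists eta, 0 < eta /\
            forall s t, Rabs (t - s) < eta -> Cmod (RtoC (t - s) * (b - a))%C < eps).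
  { intros eps Heps. exists (eps / L). split; [now apply Rdiv_lt_0_compat|].
    intros s t Hst. rewrite Hdist.
    apply Rlt_le_trans with (eps / L * L); [now apply Rmult_lt_compat_r|].
    apply Req_le. field. lra. }
  assert (Hg0 : gam 0 = a) by (unfold gam; ring).
  assert (Hg1 : gam 1 = b) by (unfold gam; ring).
  destruct (Hsmall d0 Hd0) as (e0 & He0 & Hs0).
  pose proof (Rmin_l (e0 / 2) 1) as HT0l. pose proof (Rmin_r (e0 / 2) 1) as HT0r.
  assert (HT0 : 0 < Rmin (e0 / 2) 1) by (apply Rmin_pos; lra).
  set (T0 := Rmin (e0 / 2) 1) in *.
  assert (HET0 : E T0).
  { split; [lra|]. intros t Ht. rewrite (Hgam 0 t), Hg0. apply Hc0, Hs0.
    rewrite Rminus_0_r, Rabs_pos_eq; lra. }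
  destruct (completeness E) as (T & HTub & HTlub).
  { exists 1. intros x [Hx _]. lra. }
  { now exists T0. }
  assert (HT : T0 <= T <= 1).
  { split; [now apply HTub|]. apply HTlub. intros x [Hx _]. lra. }
  assert (Hbelow : forall t, 0 <= t < T -> F (gam t) = F a).
  { intros t Ht. apply NNPP. intros Hne.
    assert (T <= t); [|lra]. apply HTlub. intros x [Hx Hxe].
    apply Rnot_lt_le. intros Hlt. apply Hne, Hxe. lra. }
  destruct (local_form_constant_or_isolated F (gam T) (F a)) as [(d & Hd & Hc)|(d & Hd & Hi)].
  { apply (analytic_local_form U); [exact HF|]. apply HU. lra. }
  - destruct (Hsmall d Hd) as (eta & Heta & Hs).
    assert (Hnear : forall t, Rabs (t - T) < eta -> F (gam t) = F (gam T)).
    { intros t Ht. rewrite (Hgam T t). now apply Hc, Hs. }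
    set (h := Rmin T eta / 2).
    pose proof (Rmin_l T eta). pose proof (Rmin_r T eta).
    assert (0 < Rmin T eta) by (apply Rmin_pos; lra).
    assert (HFT : F (gam T) = F a).
    { rewrite <- (Hnear (T - h)).
      - apply Hbelow. unfold h. lra.
      - replace (T - h - T) with (- h) by ring. rewrite Rabs_Ropp, Rabs_pos_eq; unfold h; lra. }
    destruct (Req_dec T 1) as [->|HT1]; [now rewrite Hg1 in HFT|].
    exfalso.
    pose proof (Rmin_l 1 (T + eta / 2)). pose proof (Rmin_r 1 (T + eta / 2)).
    assert (T < Rmin 1 (T + eta / 2)) by (apply Rmin_glb_lt; lra).
    set (T' := Rmin 1 (T + eta / 2)) in *.
    assert (E T'); [|assert (T' <= T) by (now apply HTub); lra].
    split; [lra|]. intros t Ht.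
    destruct (Rlt_le_dec t T) as [HtT|HtT]; [apply Hbelow; lra|].
    rewrite Hnear; [exact HFT|]. rewrite Rabs_pos_eq; lra.
  - exfalso.
    destruct (Hsmall d Hd) as (eta & Heta & Hs).
    set (h := Rmin T eta / 2).
    pose proof (Rmin_l T eta). pose proof (Rmin_r T eta).
    assert (0 < Rmin T eta) by (apply Rmin_pos; lra).
    assert (Habs : Rabs (T - h - T) = h).
    { replace (T - h - T) with (- h) by ring. rewrite Rabs_Ropp, Rabs_pos_eq; unfold h; lra. }
    apply (Hi (RtoC (T - h - T) * (b - a))%C).
    + intros E0. apply (f_equal Cmod) in E0. rewrite Hdist, Cmod_0, Habs in E0.
      assert (0 < h * L) by (apply Rmult_lt_0_compat; unfold h; lra). lra.
    + apply Hs. rewrite Habs. unfold h. lra.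
    + rewrite <- Hgam. apply Hbelow. unfold h. lra.
Qed.

Lemma unit_disc_convex (a b : C) (t : R) :
  unit_disc a -> unit_disc b -> 0 <= t <= 1 -> unit_disc (a + t * (b - a))%C.
Proof.
  unfold unit_disc. intros Ha Hb Ht.
  replace (a + t * (b - a))%C with (RtoC (1 - t) * a + t * b)%C
    by (rewrite RtoC_minus; ring).
  eapply Rle_trans; [apply Cmod_triangle|].
  rewrite !Cmod_mult, !Cmod_RtoC_nonneg by lra. nra.
Qed.

Lemma identity_on_unit_disc (U : C -> Prop) (F : C -> C) (z0 z : C) :
  analytic_on_open U F -> (forall z, unit_disc z -> U z) ->
  unit_disc z0 -> locally_constant_at F z0 -> unit_disc z -> F z = F z0.
Proof.
  intros HF HU Hz0 Hc Hz. apply (identity_on_segment U); [exact HF| |exact Hc].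
  intros t Ht. apply HU. now apply unit_disc_convex.
Qed.

(** * Maxima on the closed disc *)

Lemma list_argmax {A : Type} (f : A -> R) (l : list A) (x : A) :
  In x l -> exists y, In y l /\ forall z, In z l -> f z <= f y.
Proof.
  revert x. induction l as [|b l IH]; intros x Hx; [destruct Hx|].
  destruct l as [|b' l].
  - exists b. split; [now left|]. intros z [->|[]]. lra.
  - destruct (IH b' (or_introl eq_refl)) as (y & Hy & Hmax).
    destruct (Rle_dec (f b) (f y)) as [Hle|Hle].
    + exists y. split; [now right|]. intros z [<-|Hz]; [exact Hle|now apply Hmax].
    + exists b. split; [now left|]. intros z [<-|Hz]; [lra|]. specialize (Hmax z Hz). lra.
Qed.

Lemma unit_disc_closed (z : C) :
  ~ unit_disc z -> exists delta, 0 < delta /\ forall w, Cmod w < delta -> ~ unit_disc (z + w)%C.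
Proof.
  unfold unit_disc. intros Hz. exists (Cmod z - 1). split; [lra|]. intros w Hw Hd.
  pose proof (Cmod_sub_triangle (z + w)%C w) as H.
  replace (z + w - w)%C with z in H by ring. lra.
Qed.

(** If no point is a maximum, then around each point of the disc there is a box on
    which [u] stays below its value at some other point.  Finitely many boxes cover
    the disc; the largest of the corresponding values is taken at a point which lies in
    one of the boxes, and hence is smaller than another of these values. *)
Lemma unit_disc_attains_max (u : C -> R) :
  (forall z, unit_disc z -> forall eps, 0 < eps -> exists delta, 0 < delta /\
    forall w, Cmod w < delta -> unit_disc (z + w)%C -> Rabs (u (z + w)%C - u z) < eps) ->
  exists z0, unit_disc z0 /\ forall z, unit_disc z -> u z <= u z0.
Proof.
  intros Hu. apply NNPP. intros Hno.
  assert (Hup : forall z, unit_disc z -> exists z', unit_disc z' /\ u z < u z').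
  { intros z Hz. apply NNPP. intros Hn. apply Hno. exists z. split; [exact Hz|].
    intros z' Hz'. apply Rnot_lt_le. intros Hlt. apply Hn. now exists z'. }
  assert (Hcover : forall p : Compactness.Tn 2 R, exists dw : posreal * C,
    unit_disc (snd dw) /\ forall z : C, unit_disc z ->
      close_n 2 (fst dw) (fst z, (snd z, tt)) p -> u z < u (snd dw)).
  { intros (x & y & []). set (p := (x, y) : C).
    (* Outside the disc, which is closed, a box that misses the disc will do, with
       any value for the witness. *)
    assert (H : exists delta z', 0 < delta /\ unit_disc z' /\
      forall w, Cmod w < delta -> unit_disc (p + w)%C -> u (p + w)%C < u z').
    { destruct (classic (unit_disc p)) as [Hp|Hp].
      - destruct (Hup p Hp) as (z' & Hz' & Hlt).
        destruct (Hu p Hp (u z' - u p) ltac:(lra)) as (delta & Hdelta & H).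
        exists delta, z'. repeat split; auto. intros w Hw Hpw.
        specialize (H w Hw Hpw). apply Rabs_lt_between in H. lra.
      - destruct (unit_disc_closed p Hp) as (delta & Hdelta & H).
        exists delta, (RtoC 0). repeat split; auto.
        + unfold unit_disc. rewrite Cmod_0. lra.
        + intros w Hw Hpw. now destruct (H w Hw). }
    destruct H as (delta & z' & Hdelta & Hz' & H).
    (* A box of half-side [delta / 2] lies in the ball of radius [delta] since
       [sqrt 2 < 2]. *)
    exists (mkposreal (delta / 2) (is_pos_div_2 (mkposreal delta Hdelta)), z').
    split; [exact Hz'|]. intros z Hz. simpl. intros (H1 & H2 & _).
    assert (E : z = (p + (z - p))%C) by ring. rewrite E. apply H; [|now rewrite <- E].
    eapply Rle_lt_trans; [apply Cmod_2Rmax|].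
    assert (Hmax : Rmax (Rabs (fst (z - p)%C)) (Rabs (snd (z - p)%C)) < delta / 2).
    { apply Rmax_lub_lt; assumption. }
    assert (Hs2 : sqrt 2 < 2).
    { rewrite <- (sqrt_square 2) at 2 by lra. apply sqrt_lt_1; lra. }
    pose proof (sqrt_lt_R0 2 ltac:(lra)).
    assert (0 <= Rmax (Rabs (fst (z - p)%C)) (Rabs (snd (z - p)%C))).
    { eapply Rle_trans; [apply Rabs_pos|apply Rmax_l]. }
    nra. }
  apply functional_choice in Hcover. destruct Hcover as [f Hf].
  apply (compactness_list 2 (-1, (-1, tt)) (1, (1, tt)) (fun p => fst (f p))).
  intros [l Hl].
  assert (Hin : forall z, unit_disc z -> exists t, In t l /\ u z < u (snd (f t))).
  { intros z Hz. destruct (Hl (fst z, (snd z, tt))) as (t & Ht & _ & Hclose).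
    - pose proof (Rmax_Cmod z) as Hm. unfold unit_disc in Hz.
      pose proof (Rmax_l (Rabs (fst z)) (Rabs (snd z))).
      pose proof (Rmax_r (Rabs (fst z)) (Rabs (snd z))).
      split; [|split; [|exact I]]; apply Rabs_le_between; lra.
    - exists t. split; [exact Ht|]. now apply Hf. }
  destruct (Hin (RtoC 0)) as (t & Ht & _).
  { unfold unit_disc. rewrite Cmod_0. lra. }
  destruct (list_argmax (fun t => u (snd (f t))) l t Ht) as (s & Hs & Hmax).
  destruct (Hin (snd (f s)) (proj1 (Hf s))) as (t' & Ht' & Hlt).
  specialize (Hmax t' Ht'). simpl in Hmax. lra.
Qed.

(** * The Schwarz lemma *)

(** Away from the origin, dividing by [z0 + w] amounts to dividing the
    leading coefficient by [z0]; replacing [z0 + w] by [z0] in the leading term costs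
    one more power of [w]. *)
Lemma leading_term_quotient_nonzero (G k : C -> C) (z0 c : C) (m : nat) :
  (forall z, G z = z * (k z - k z0))%C -> z0 <> RtoC 0 ->
  leading_term G z0 c m -> leading_term k z0 (c / z0)%C m.
Proof.
  intros HG Hz0 (K & rho & HK & Hrho & H).
  pose proof (proj1 (Cmod_gt_0 _) Hz0) as HM.
  set (M := Cmod z0) in *.
  exists ((K + Cmod (c / z0)%C) * (2 / M)), (Rmin rho (M / 2)).
  pose proof (Cmod_ge_0 (c / z0)%C) as Hc.
  assert (H2M : 0 < 2 / M) by (apply Rdiv_lt_0_compat; lra).
  split; [apply Rmult_lt_0_compat; lra|]. split; [apply Rmin_pos; lra|].
  intros w Hw. pose proof (Rmin_l rho (M / 2)). pose proof (Rmin_r rho (M / 2)).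
  specialize (H w ltac:(lra)).
  assert (Hzw : M / 2 <= Cmod (z0 + w)%C).
  { pose proof (Cmod_sub_triangle (z0 + w)%C w) as Ht.
    replace (z0 + w - w)%C with z0 in Ht by ring. fold M in Ht. lra. }
  rewrite !HG in H.
  replace (z0 * (k z0 - k z0))%C with (RtoC 0) in H by ring.
  set (A := (k (z0 + w) - k z0 - c / z0 * w ^ m)%C).
  assert (HA : ((z0 + w) * A = ((z0 + w) * (k (z0 + w) - k z0) - 0 - c * w ^ m)
                 - c / z0 * w ^ S m)%C).
  { unfold A. rewrite Cpow_S. field. exact Hz0. }
  apply (f_equal Cmod) in HA. rewrite Cmod_mult in HA.
  assert (HA2 : Cmod (z0 + w)%C * Cmod A <= (K + Cmod (c / z0)%C) * Cmod w ^ S m).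
  { rewrite HA. eapply Rle_trans; [apply Cmod_sub_triangle|].
    rewrite Cmod_mult, Cmod_pow. lra. }
  pose proof (Cmod_ge_0 A) as HA0.
  assert (HA3 : M / 2 * Cmod A <= (K + Cmod (c / z0)%C) * Cmod w ^ S m) by nra.
  apply (Rmult_le_reg_l (M / 2)); [lra|]. eapply Rle_trans; [exact HA3|].
  apply Req_le. field. lra.
Qed.

Lemma leading_term_quotient_zero (G k : C -> C) (c : C) (m : nat) :
  (forall z, G z = z * (k z - k (RtoC 0)))%C -> (1 <= m)%nat ->
  leading_term G (RtoC 0) c (S m) -> leading_term k (RtoC 0) c m.
Proof.
  intros HG Hm (K & rho & HK & Hrho & H).
  exists K, rho. repeat split; auto. intros w Hw. specialize (H w Hw).
  rewrite !HG in H.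
  assert (E : (0 + w = w)%C) by ring. rewrite E in H |- *.
  destruct (classic (w = RtoC 0)) as [->|Hw0].
  - destruct m as [|m]; [lia|]. rewrite Cpow_S.
    match goal with |- Cmod ?x <= _ => replace x with (RtoC 0) by ring end.
    rewrite Cmod_0. simpl. lra.
  - apply Cmod_gt_0 in Hw0.
    match type of H with Cmod ?x <= _ =>
      replace x with (w * (k w - k (RtoC 0) - c * w ^ m))%C in H by (rewrite Cpow_S; ring) end.
    rewrite Cmod_mult in H. rewrite <- tech_pow_Rmult in H.
    apply (Rmult_le_reg_l (Cmod w)); lra.
Qed.

Lemma quotient_locally_constant (G k : C -> C) (z0 : C) :
  (forall z, G z = z * (k z - k z0))%C -> locally_constant_at G z0 ->
  locally_constant_at k z0.
Proof.
  intros HG (delta & Hdelta & H).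
  assert (Hdelta' : exists d, 0 < d <= delta /\ forall w, Cmod w < d -> w <> RtoC 0 -> (z0 + w)%C <> RtoC 0).
  { destruct (classic (z0 = RtoC 0)) as [->|Hz0].
    - exists delta. split; [lra|]. intros w _ Hw E. apply Hw. rewrite <- E. ring.
    - pose proof (proj1 (Cmod_gt_0 _) Hz0) as HM.
      exists (Rmin delta (Cmod z0)). split; [split; [now apply Rmin_pos|apply Rmin_l]|].
      intros w Hw _ E. pose proof (Rmin_r delta (Cmod z0)).
      assert (E' : w = (- z0)%C).
      { replace w with ((z0 + w) - z0)%C by ring. rewrite E. ring. }
      rewrite E', Cmod_opp in Hw. lra. }
  destruct Hdelta' as (d & [Hd1 Hd2] & Hne).
  exists d. split; [exact Hd1|]. intros w Hw.
  destruct (classic (w = RtoC 0)) as [->|Hw0]; [f_equal; ring|].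
  specialize (H w ltac:(lra)). rewrite !HG in H.
  specialize (Hne w Hw Hw0).
  replace (k (z0 + w)%C) with ((z0 + w) * (k (z0 + w) - k z0) / (z0 + w) + k z0)%C
    by (field; exact Hne).
  rewrite H. field. exact Hne.
Qed.

(** The value of [k] at the origin is the linear coefficient [a 1].  With this choice
    the linear coefficient of [g z - k 0 z] vanishes, so a leading term at the origin has
    exponent at least 2 and remains one after division by [z]. *)
Lemma quotient_local_form (U : C -> Prop) (g : C -> C) :
  analytic_on_open U g -> U (RtoC 0) -> g (RtoC 0) = RtoC 0 ->
  exists k : C -> C, (forall z, g z = z * k z)%C /\
    forall z0, U z0 -> local_form_at k z0.
Proof.
  intros Hg HU0 Hg0.
  destruct (analytic_series_at U g (RtoC 0) Hg HU0) as (r & a & Hr & Ha).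
  pose (k := fun z : C => if Req_EM_T (Cmod z) 0 then a 1%nat else (g z / z)%C).
  assert (Hk0 : k (RtoC 0) = a 1%nat).
  { unfold k. destruct (Req_EM_T (Cmod 0) 0) as [_|H]; [reflexivity|].
    destruct H. apply Cmod_0. }
  assert (Hk : forall z, (g z = z * k z)%C).
  { intros z. destruct (classic (z = RtoC 0)) as [->|Hz]; [rewrite Hg0; ring|].
    unfold k. destruct (Req_EM_T (Cmod z) 0) as [E|_].
    - now apply Cmod_eq_0 in E.
    - field. exact Hz. }
  exists k. split; [exact Hk|]. intros z0 Hz0.
  pose (G := fun z => (g z - k z0 * z)%C).
  assert (HG : forall z, (G z = z * (k z - k z0))%C).
  { intros z. unfold G. rewrite (Hk z) at 1. ring. }
  destruct (classic (z0 = RtoC 0)) as [->|Hz].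
  - pose proof (fun w Hw => pseries_sub_affine a w _ (RtoC 0) (a 1%nat) (proj2 (Ha w Hw))) as HGs.
    destruct (pseries_dichotomy G (RtoC 0) r
      (fun n => match n with 0%nat => a 0%nat - 0 | 1%nat => a 1%nat - a 1%nat | _ => a n end)%C Hr)
      as [H|(m & Hm & Ham & H)].
    + intros w Hw. specialize (HGs w Hw).
      replace (G (0 + w)%C) with (g (0 + w) - (0 + a 1%nat * w))%C; [exact HGs|].
      unfold G. rewrite Hk0. ring.
    + left. apply (quotient_locally_constant G); [exact HG|]. now exists r.
    + right. destruct m as [|[|m]]; [lia| |].
      * destruct Ham. ring.
      * exists (S m), (a (S (S m))). split; [lia|]. split; [exact Ham|].
        apply (leading_term_quotient_zero G); [exact HG|lia|exact H].
  - destruct (analytic_local_form U G z0) as [H|(m & c & Hm & Hc & H)].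
    + now apply analytic_sub_linear.
    + exact Hz0.
    + left. now apply (quotient_locally_constant G).
    + right. exists m, (c / z0)%C. split; [exact Hm|]. split.
      * intros E. apply Hc. replace c with (c / z0 * z0)%C by (field; exact Hz).
        rewrite E. ring.
      * now apply (leading_term_quotient_nonzero G).
Qed.

(** Let [|k|], where [g z = z k z], attain its maximum at [z0].  If [z0] lies on the circle, then
    [|k z0| = |g z0| <= M].  Otherwise [k] is constant near [z0], so [g z = k z0 * z]
    on the whole disc by the identity theorem, and [k z0 = g 1]. *)
Lemma Schwarz_lemma (U : C -> Prop) (g : C -> C) (M : R) :
  analytic_on_open U g -> (forall z, unit_disc z -> U z) ->
  g (RtoC 0) = RtoC 0 -> (forall z, unit_disc z -> Cmod (g z) <= M) ->
  forall z, unit_disc z -> Cmod (g z) <= M * Cmod z.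
Proof.
  intros Hg HU Hg0 HM.
  assert (Hd0 : unit_disc (RtoC 0)) by (unfold unit_disc; rewrite Cmod_0; lra).
  destruct (quotient_local_form U g Hg (HU _ Hd0) Hg0) as (k & Hk & Hform).
  destruct (unit_disc_attains_max (fun z => Cmod (k z))) as (z0 & Hz0 & Hmax).
  { intros z Hz eps Heps.
    destruct (local_form_continuous k z (Hform z (HU z Hz)) eps Heps) as (delta & Hdelta & H).
    exists delta. split; [exact Hdelta|]. intros w Hw _.
    eapply Rle_lt_trans; [apply Cmod_reverse_triangle|now apply H]. }
  assert (Hlam : Cmod (k z0) <= M).
  { destruct (Rle_lt_or_eq_dec _ _ Hz0) as [Hlt|Heq].
    - assert (Hc : locally_constant_at k z0).
      { apply (local_max_locally_constant k z0 (1 - Cmod z0)); [now apply Hform, HU|lra|].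
        intros w Hw. apply Hmax. unfold unit_disc.
        eapply Rle_trans; [apply Cmod_triangle|lra]. }
      destruct Hc as (delta & Hdelta & Hc).
      assert (HG0 : forall w, Cmod w < delta -> (g (z0 + w) - k z0 * (z0 + w) = 0)%C).
      { intros w Hw. rewrite Hk, (Hc w Hw). ring. }
      assert (HGz0 : (g z0 - k z0 * z0 = 0)%C) by (rewrite Hk; ring).
      assert (Hd1 : unit_disc (RtoC 1)) by (unfold unit_disc; rewrite Cmod_1; lra).
      assert (H1 : (g 1 - k z0 * 1 = g z0 - k z0 * z0)%C).
      { apply (identity_on_unit_disc U (fun z => g z - k z0 * z)%C); auto.
        - now apply analytic_sub_linear.
        - exists delta. split; [exact Hdelta|]. intros w Hw. now rewrite HG0, HGz0. }
      rewrite HGz0 in H1.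
      replace (k z0) with (g 1)%C; [now apply HM|].
      replace (g 1)%C with ((g 1 - k z0 * 1) + k z0)%C by ring. rewrite H1. ring.
    - specialize (HM z0 Hz0). rewrite Hk, Cmod_mult, Heq in HM. lra. }
  intros z Hz. rewrite Hk, Cmod_mult, Rmult_comm.
  apply Rmult_le_compat_r; [apply Cmod_ge_0|]. specialize (Hmax z Hz). simpl in Hmax. lra.
Qed.

(** * Behaviour at a boundary maximum *)

Lemma inward_direction (v : C) :
  Re v < 0 -> exists s1, 0 < s1 /\ forall s, 0 < s < s1 -> Cmod (1 + s * v)%C <= 1.
Proof.
  intros Hv. destruct v as [x y]. simpl in Hv.
  assert (Hd : 0 < x * x + y * y) by nra.
  exists (- 2 * x / (x * x + y * y)). split; [apply Rdiv_lt_0_compat; lra|].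
  intros s [Hs0 Hs1].
  assert (Hs : s * (x * x + y * y) < - 2 * x).
  { apply Rlt_le_trans with (- 2 * x / (x * x + y * y) * (x * x + y * y)).
    - now apply Rmult_lt_compat_r.
    - apply Req_le. field. lra. }
  apply Rle_trans with (sqrt 1); [|rewrite sqrt_1; lra].
  unfold Cmod. apply sqrt_le_1_alt. simpl.
  assert (0 <= s * (- 2 * x - s * (x * x + y * y))) by (apply Rmult_le_pos; lra). lra.
Qed.

(** A direction [alpha v] with [Re v < 0] points into the disc, so the modulus cannot
    increase along it. *)
Lemma boundary_max_variation (g : C -> C) (alpha c : C) (m : nat) :
  unit_circle alpha -> g alpha <> RtoC 0 -> leading_term g alpha c m ->
  (forall z, unit_disc z -> Cmod (g z) <= Cmod (g alpha)) ->
  forall v, Re v < 0 -> Re (c * alpha ^ m / g alpha * v ^ m)%C <= 0.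
Proof.
  intros Halpha Hg0 Hlead Hmax v Hv. apply Rnot_lt_le. intros Hpos.
  destruct (inward_direction v Hv) as (s1 & Hs1 & Hin).
  destruct (leading_term_increase g alpha c (alpha * v)%C m Hlead Hg0) as (s0 & Hs0 & Hinc).
  { replace (c * (alpha * v) ^ m / g alpha)%C with (c * alpha ^ m / g alpha * v ^ m)%C;
      [exact Hpos|]. rewrite Cpow_mult_l. field. exact Hg0. }
  assert (0 < Rmin s0 s1) by now apply Rmin_pos.
  pose proof (Rmin_l s0 s1). pose proof (Rmin_r s0 s1).
  set (s := Rmin s0 s1 / 2).
  specialize (Hinc s ltac:(unfold s; lra)). specialize (Hin s ltac:(unfold s; lra)).
  specialize (Hmax (alpha + s * (alpha * v))%C).
  enough (Hdisc : unit_disc (alpha + s * (alpha * v))%C) by (specialize (Hmax Hdisc); lra).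
  unfold unit_disc.
  replace (alpha + s * (alpha * v))%C with (alpha * (1 + s * v))%C by ring.
  rewrite Cmod_mult, Halpha. lra.
Qed.

(** Testing [v = -1 + i t] gives [Re d + t Im d >= 0] for every real [t]. *)
Lemma half_plane_positive (d : C) :
  d <> RtoC 0 -> (forall v, Re v < 0 -> Re (d * v)%C <= 0) -> Im d = 0 /\ 0 < Re d.
Proof.
  destruct d as [x y]. intros Hd H. simpl.
  pose proof (H (-1, 0) ltac:(simpl; lra)) as H0. simpl in H0.
  assert (Hy : y = 0).
  { apply NNPP. intros Hy.
    (* This slope makes [Re (d v)] equal to [1]. *)
    pose proof (H (-1, - (x + 1) / y) ltac:(simpl; lra)) as H1. simpl in H1.
    assert (E : y * (- (x + 1) / y) = - (x + 1)) by (field; exact Hy). lra. }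
  subst y. split; [reflexivity|].
  destruct (Req_dec x 0) as [->|Hx]; [now destruct Hd|lra].
Qed.

(** For [m >= 2] the ascent direction can be chosen inside the disc, contradicting
    maximality. *)
Lemma boundary_max_leading_term (g : C -> C) (alpha c : C) (m : nat) :
  unit_circle alpha -> g alpha <> RtoC 0 -> c <> RtoC 0 -> (1 <= m)%nat ->
  leading_term g alpha c m ->
  (forall z, unit_disc z -> Cmod (g z) <= Cmod (g alpha)) ->
  m = 1%nat /\ Im (alpha * (c / g alpha))%C = 0 /\ 0 < Re (alpha * (c / g alpha))%C.
Proof.
  intros Halpha Hg0 Hc Hm Hlead Hmax.
  pose proof (boundary_max_variation g alpha c m Halpha Hg0 Hlead Hmax) as Hvar.
  assert (Hd : (c * alpha ^ m / g alpha)%C <> RtoC 0).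
  { apply Cmod_gt_0. rewrite Cmod_div, Cmod_mult, Cmod_pow, Halpha, pow1, Rmult_1_r by exact Hg0.
    apply Rdiv_lt_0_compat; now apply Cmod_gt_0. }
  assert (Hm1 : m = 1%nat).
  { destruct (exists_ascent_direction _ m Hd Hm) as (v & _ & Hpos & Hv).
    destruct (Nat.eq_dec m 1) as [E|E]; [exact E|].
    specialize (Hvar v (Hv ltac:(lia))). lra. }
  split; [exact Hm1|]. subst m.
  replace (alpha * (c / g alpha))%C with (c * alpha ^ 1 / g alpha)%C by (field; exact Hg0).
  apply half_plane_positive; [exact Hd|]. intros v Hv. specialize (Hvar v Hv).
  now rewrite (Cpow_1_r v) in Hvar.
Qed.

(** Compare, at [z = (1 - s) alpha], the first-order lower bound for [|g z|] with the
    hypothesis, and let [s] tend to [0]. *)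
Lemma boundary_derivative_ge_1 (g : C -> C) (alpha c : C) :
  unit_circle alpha -> g alpha <> RtoC 0 -> leading_term g alpha c 1 ->
  (forall z, unit_disc z -> Cmod (g z) <= Cmod (g alpha) * Cmod z) ->
  1 <= Re (alpha * (c / g alpha))%C.
Proof.
  intros Halpha Hg0 Hlead Hg.
  destruct (leading_term_first_variation g alpha c 1 Hlead Hg0 (- alpha)%C)
    as (K & s0 & HK & Hs0 & H).
  set (q := (alpha * (c / g alpha))%C).
  assert (Hq : Re (c * (- alpha) ^ 1 / g alpha)%C = - Re q).
  { replace (c * (- alpha) ^ 1 / g alpha)%C with (- q)%C by (unfold q; field; exact Hg0).
    reflexivity. }
  rewrite Hq in H.
  pose proof (proj1 (Cmod_gt_0 _) Hg0) as HM.
  apply le_epsilon. intros eps Heps.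
  set (s := Rmin (Rmin s0 1) (eps / K) / 2).
  assert (He : 0 < eps / K) by (apply Rdiv_lt_0_compat; lra).
  assert (0 < Rmin (Rmin s0 1) (eps / K)) by (repeat apply Rmin_pos; lra).
  pose proof (Rmin_l (Rmin s0 1) (eps / K)). pose proof (Rmin_r (Rmin s0 1) (eps / K)).
  pose proof (Rmin_l s0 1). pose proof (Rmin_r s0 1).
  assert (Hs : 0 < s < s0) by (unfold s; lra).
  assert (Hs1 : s < 1) by (unfold s; lra).
  assert (HsK : K * s <= eps).
  { apply Rle_trans with (K * (eps / K)); [apply Rmult_le_compat_l; unfold s; lra|].
    apply Req_le. field. lra. }
  specialize (H s Hs). rewrite pow_1 in H.
  assert (Hz : Cmod (alpha + s * - alpha)%C = 1 - s).
  { replace (alpha + s * - alpha)%C with (RtoC (1 - s) * alpha)%C by (rewrite RtoC_minus; ring).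
    rewrite Cmod_mult, Halpha, Cmod_RtoC_nonneg; lra. }
  specialize (Hg (alpha + s * - alpha)%C). unfold unit_disc in Hg. rewrite Hz in Hg.
  specialize (Hg ltac:(lra)).
  assert (H5 : 1 + s * (- Re q - K * s) <= 1 - s).
  { apply (Rmult_le_reg_l (Cmod (g alpha))); lra. }
  assert (H6 : s * (1 - Re q - K * s) <= 0) by lra.
  nra.
Qed.

Theorem theorem10p2 :
  forall (f : C -> C) (alpha : C),
    (forall z : C, unit_disc z -> unit_disc (f z)) ->
    (exists z w : C, unit_disc z /\ unit_disc w /\ f z <> f w) ->
    analytic_in unit_disc f ->
    unit_circle alpha ->
    (forall z : C, unit_disc z -> (Cmod (f z) <= Cmod (f alpha))%R) ->
    forall (U : C -> Prop) (g : C -> C),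
      analytic_extension unit_disc f U g ->
      @ex_derive C_AbsRing C_NormedModule g alpha /\
      let q : C := (alpha * (C_derive g alpha / f alpha))%C in
      (Im q = 0%R /\ (0 < Re q)%R) /\
      (f (RtoC 0) = RtoC 0 -> (1 <= Re q)%R).
Proof.
  intros f alpha _ (z1 & z2 & Hz1 & Hz2 & Hne) _ Halpha Hmax U g (Hg & HU & Hfg).
  assert (Hda : unit_disc alpha) by (unfold unit_disc; rewrite Halpha; lra).
  assert (Hgmax : forall z, unit_disc z -> Cmod (g z) <= Cmod (g alpha)).
  { intros z Hz. rewrite !Hfg by assumption. now apply Hmax. }
  assert (Hg0 : g alpha <> RtoC 0).
  { intros E. apply Hne. rewrite <- !Hfg by assumption.
    assert (Hzero : forall z, unit_disc z -> g z = RtoC 0).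
    { intros z Hz. apply Cmod_eq_0. specialize (Hgmax z Hz). rewrite E, Cmod_0 in Hgmax.
      pose proof (Cmod_ge_0 (g z)). lra. }
    now rewrite !Hzero. }
  destruct (analytic_local_form U g alpha Hg (HU _ Hda)) as [Hc|(m & c & Hm & Hc & Hlead)].
  { destruct Hne. rewrite <- !Hfg by assumption.
    transitivity (g alpha); [|symmetry]; now apply (identity_on_unit_disc U). }
  destruct (boundary_max_leading_term g alpha c m Halpha Hg0 Hc Hm Hlead Hgmax)
    as (-> & Him & Hre).
  pose proof (leading_term_is_derive g alpha c Hlead) as Hder.
  split; [now exists c|].
  rewrite (is_C_derive_unique g alpha c Hder), <- (Hfg alpha Hda).
  intros q. split; [now split|]. intros Hf0.
  apply boundary_derivative_ge_1; try assumption.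
  apply (Schwarz_lemma U); try assumption.
  rewrite Hfg; [exact Hf0|]. unfold unit_disc. rewrite Cmod_0. lra.
Qed.
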